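(* Let $X$ be the number of bulbs on at the terminal time $n$ in the standard lightbulb process on $n$ bulbs, and let $Z$ be a standard normal random variable. (i) For all even $n \ge 6$, with $$\sigma^2=\frac{n}{4}\left(1-\lambda_{n,2,\mathbf{n}}\right)+\frac{n^2}{4}\lambda_{n,2,\mathbf{n}},$$ we have $$\sup_{z\in\mathbb{R}}\left|P\left(\frac{X-n/2}{\sigma}\le z\right)-P(Z\le z)\right|\le \frac{n}{2\sigma^2}\overline{\Delta}_0+1.64\frac{n}{\sigma^3}+\frac{2}{\sigma},\qquad \overline{\Delta}_0=\frac{1}{2\sqrt{n}}+\frac{1}{2n}+\frac13 e^{-n/2}.$$ (ii) For all odd $n=2m+1\ge 7$, with $$\sigma_V^2=\frac{n}{4}\left(1-\overline{\lambda}_{n,2,\mathbf{n}}\right)+\frac{n^2}{4}\overline{\lambda}_{n,2,\mathbf{n}},$$ we have $$\sup_{z\in\mathbb{R}}\left|P\left(\frac{X-n/2}{\sigma_V}\le z\right)-P(Z\le z)\right|\le \frac{n}{2\sigma_V^2}\overline{\Delta}_1+1.64\frac{n}{\sigma_V^3}+\frac{2}{\sigma_V}\left(1+\frac{1}{\sqrt{2\pi}}\right),\qquad \overline{\Delta}_1=\frac{1}{\sqrt{n}}+\frac{1}{2\sqrt2}e^{-n/4}.$$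
   Context: Lightbulb process: there are $n$ bulbs, all initially off, and $k$ stages with switch pattern $\mathbf{s}=(s_1,\dots,s_k)$, $s_r\in\{0,\dots,n\}$. At stage $r$ a subset of exactly $s_r$ of the $n$ bulbs is chosen uniformly at random, independently of the other stages, and each chosen bulb has its status toggled (off to on or on to off). Formally, switch variables $X_{rj}\in\{0,1\}$ ($r=1,\dots,k$, $j=1,\dots,n$) have $P(X_{rj}=e_{rj}\ \forall r,j)=\prod_{r=1}^k\binom{n}{s_r}^{-1}$ if $\sum_j e_{rj}=s_r$ for all $r$ and $0$ otherwise; $X_j=(\sum_r X_{rj})\bmod 2$ indicates bulb $j$ is on at the end, and $X_{\mathbf{s}}=\sum_j X_j$. The standard lightbulb process is the case $k=n$, $\mathbf{s}=\mathbf{n}=(1,2,\dots,n)$ (on day $r$ exactly $r$ bulbs are toggled), and $X=X_{\mathbf{n}}$. For integers $n,b,s$ define $(n)_t=n(n-1)\cdots(n-t+1)$, $$\lambda_{n,b,s}=\sum_{t=0}^b\binom{b}{t}(-2)^t\frac{(s)_t}{(n)_t},\qquad \lambda_{n,b,\mathbf{s}}=\prod_{r=1}^k\lambda_{n,b,s_r}.$$ For $n=2m+1$ odd, $\overline{\lambda}_{n,b,\mathbf{n}}$ is obtained from $\lambda_{n,b,\mathbf{n}}=\prod_{s=1}^n\lambda_{n,b,s}$ by replacing each of the factors $\lambda_{n,b,m}$ and $\lambda_{n,b,m+1}$ by their average $\frac12(\lambda_{n,b,m}+\lambda_{n,b,m+1})$. *)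

(* Defs.v *)
From HB Require Import structures.
From mathcomp Require Import all_boot all_order all_algebra.
From mathcomp Require Import all_classical all_reals all_analysis.
Set Implicit Arguments. Unset Strict Implicit. Unset Printing Implicit Defensive.
Import Order.TTheory GRing.Theory Num.Theory.
Local Open Scope ring_scope.

(* A configuration of switch variables: e r = set of bulbs j with e_{rj} = 1,
   for r : 'I_k (stage r.+1) and bulbs in 'I_n. *)
Definition switch_config (n k : nat) := {ffun 'I_k -> {set 'I_n}}.

Definition admissible n k (s : 'I_k -> nat) (e : switch_config n k) : bool :=
  [forall r, #|e r| == s r].

Definition config_prob {R : realType} n k (s : 'I_k -> nat)
    (e : switch_config n k) : R :=
  if admissible s e then \prod_(r < k) ('C(n, s r)%:R)^-1 else 0.

Definition bulb_on n k (e : switch_config n k) (j : 'I_n) : bool :=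
  odd #|[set r : 'I_k | j \in e r]|.

Definition Xs n k (e : switch_config n k) : nat :=
  \sum_(j < n) bulb_on e j.

Definition lb_prob {R : realType} n k (s : 'I_k -> nat)
    (E : pred (switch_config n k)) : R :=
  \sum_(e : switch_config n k | E e) config_prob s e.

Definition std_pattern (n : nat) : 'I_n -> nat := fun r => (val r).+1.

Definition std_lb_cdf {R : realType} (n : nat) (sig z : R) : R :=
  lb_prob (@std_pattern n)
    (fun e : switch_config n n => ((Xs e)%:R - n%:R / 2) / sig <= z).

Definition lambda_nbs {R : realType} (n b s : nat) : R :=
  \sum_(t < b.+1) ('C(b, t)%:R * (-2) ^+ t * (s ^_ t)%:R / (n ^_ t)%:R).

Definition lambda_std {R : realType} (n b : nat) : R :=
  \prod_(1 <= s < n.+1) @lambda_nbs R n b s.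

(* for n = 2m+1: factors at s = m and s = m+1 replaced by their average *)
Definition lambda_bar_std {R : realType} (n b : nat) : R :=
  let m := n./2 in
  (\prod_(1 <= s < n.+1 | (s != m) && (s != m.+1)) @lambda_nbs R n b s) *
  ((@lambda_nbs R n b m + @lambda_nbs R n b m.+1) / 2) ^+ 2.

Definition Phi {R : realType} (z : R) : R :=
  fine (normal_prob 0 1 `]-oo, z]%classic).

(* Main.v *)
(* Since the stages are independent, the law of the set of lit bulbs on the cube
   {0,1}^n has Walsh transform S |-> prod_s rho(S, s), where rho(S, s) averages
   the character of S over the s-subsets. Parseval and permutation invariance
   give rho(S, s)^2 <= 2^n / (C(n, |S|) C(n, s)), so the six central stages alone
   make all coefficients other than those of the empty and the full set
   negligible: the law is within 8/n in total variation of the uniform law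
   conditioned on the parity of 1 + ... + n. The alternating binomial sums
   telescope, so the distribution function of the count under the latter differs
   from that of Bin(n, 1/2) by at most half a binomial mass. Finally Stein's
   equation gives a Berry-Esseen bound for Bin(n, 1/2), E[(2X - n) f(X)] being a
   sum of increments of f. The total is below 16 / sqrt n for n >= 256; the
   right-hand sides always exceed 16 / sqrt n, which is at least 1 for smaller n. *)
Require Import Defs.
From HB Require Import structures.
From mathcomp Require Import all_boot all_order all_algebra.
From mathcomp Require Import all_classical all_reals all_analysis.
From mathcomp Require Import zify ring lra.
Set Implicit Arguments.
Unset Strict Implicit.
Unset Printing Implicit Defensive.
Import Order.TTheory GRing.Theory Num.Theory.
Import numFieldNormedType.Exports.
Local Open Scope ring_scope.

(** * Central binomial coefficients *)

Section CentralBinomial.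
Local Open Scope nat_scope.

Lemma leq_bin_half n k : 'C(n, k) <= 'C(n, n./2).
Proof.
have below j : j <= n./2 -> 'C(n, n./2 - j) <= 'C(n, n./2).
  elim: j => [|j IH] jn; first by rewrite subn0.
  apply: leq_trans (IH (ltnW jn)).
  have := mul_bin_left n (n./2 - j.+1).
  rewrite subnSK// => E; nia.
have [kn|nk] := leqP k n./2; first by rewrite -(subKn kn); apply: below; lia.
have [kn|kn] := leqP k n; last by rewrite bin_small.
by rewrite -bin_sub// -[n - k](@subKn _ n./2); [apply: below|]; lia.
Qed.

Lemma central_binS m : m.+1 * 'C(m.+1.*2, m.+1) = m.*2.+1.*2 * 'C(m.*2, m).
Proof.
have e1 := mul_bin_diag m.+1.*2 m; have e2 := mul_bin_diag m.*2.+1 m.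
have e3 : 'C(m.*2.+1, m.+1) = 'C(m.*2.+1, m).
  by rewrite -bin_sub; [congr 'C(_, _)|]; lia.
rewrite /= in e1 e2; rewrite e3 in e2; rewrite doubleS in e1 *.
nia.
Qed.

Lemma odd_central_bin m : 'C(m.+1.*2, m.+1) = 'C(m.*2.+1, m).*2.
Proof.
rewrite doubleS binS -[RHS]addnn; congr (_ + _).
by rewrite -bin_sub; [congr 'C(_, _)|]; lia.
Qed.

(** After multiplying by (m+1)^2, [central_binS] reduces the induction step to (2m+1)(2m+3) <=
    (2m+2)^2. The reverse bound [central_bin_ge] rests likewise on 4(m+1)(m+2) <= (2m+3)^2. *)
Lemma central_bin_le m : 'C(m.*2, m) ^ 2 * m.*2.+1 <= 4 ^ m.*2.
Proof.
elim: m => // m IH.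
have e := central_binS m.
have -> : 4 ^ m.+1.*2 = 16 * 4 ^ m.*2 by rewrite doubleS !expnS mulnA.
move: ('C(m.+1.*2, m.+1)) ('C(m.*2, m)) (4 ^ m.*2) e IH => B A E e IH.
have s0 : 0 < m.+1 ^ 2 by [].
rewrite -(leq_pmul2l s0) mulnA -expnMn e.
have : m.*2.+1 * m.+1.*2.+1 <= m.+1.*2 ^ 2 by nia.
nia.
Qed.

Lemma central_bin_ge m : 4 ^ m.+1.*2 <= 4 * m.+1 * 'C(m.+1.*2, m.+1) ^ 2.
Proof.
elim: m => // m IH.
have e := central_binS m.+1.
have -> : 4 ^ m.+2.*2 = 16 * 4 ^ m.+1.*2 by rewrite doubleS !expnS mulnA.
move: ('C(m.+2.*2, m.+2)) ('C(m.+1.*2, m.+1)) (4 ^ m.+1.*2) e IH => B A E e IH.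
have s0 : 0 < m.+2 ^ 2 by [].
rewrite -(leq_pmul2l s0) [X in _ <= X]mulnCA -expnMn e.
have : m.+1 * m.+2 * 4 <= m.+1.*2.+1 ^ 2 by nia.
nia.
Qed.

Lemma bin_sqr_le n k : 'C(n, k) ^ 2 * n.+1 <= 4 ^ n.
Proof.
apply: (@leq_trans ('C(n, n./2) ^ 2 * n.+1)).
  by rewrite leq_mul2r leq_exp2r// leq_bin_half orbT.
have [on|en] := boolP (odd n).
  (* For odd n the middle coefficient is half the central one of n + 1. *)
  have := central_bin_le n./2.+1; rewrite odd_central_bin.
  have -> : n./2.*2.+1 = n by lia.
  have -> : n./2.+1.*2 = n.+1 by lia.
  rewrite !expnS; nia.
have := central_bin_le n./2.
by have -> : n./2.*2 = n by lia.
Qed.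

Lemma bin_half_sqr_ge n : 0 < n -> 4 ^ n <= 2 * n.+1 * 'C(n, n./2) ^ 2.
Proof.
move=> n0; have [on|en] := boolP (odd n).
  have := central_bin_ge n./2; rewrite odd_central_bin.
  have -> : n./2.*2.+1 = n by lia.
  have -> : n./2.+1.*2 = n.+1 by lia.
  rewrite !expnS; nia.
have := central_bin_ge n./2.-1.
have -> : n./2.-1.+1 = n./2 by lia.
have -> : n./2.*2 = n by lia.
nia.
Qed.

(** For n >= 256, neighbouring coefficients at most four steps below the middle have ratio at most
    16/15. Four steps, squared, cost (16/15)^8 < 1.68, which fits between 2(n+1) and 4n. The upper
    half of the window is reflected; for even n this maps n/2 + 4 to n/2 - 4. *)
Lemma bin_near_half n s : 256 <= n -> n./2 <= s + 3 -> s <= n./2 + 4 ->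
  4 ^ n <= 4 * n * 'C(n, s) ^ 2.
Proof.
move=> n256.
have step k : n./2 <= k + 4 -> k < n./2 -> 15 * 'C(n, k.+1) <= 16 * 'C(n, k).
  by move=> k1 k2; have := mul_bin_left n k; nia.
suff low k : n./2 <= k + 4 -> k <= n./2 -> 4 ^ n <= 4 * n * 'C(n, k) ^ 2.
  move=> s1 s2; have [sn|ns] := leqP s n./2; first by apply: low => //; lia.
  by rewrite -bin_sub; [apply: low|]; lia.
move=> k1 k2.
have H : 15 ^ 4 * 'C(n, n./2) <= 16 ^ 4 * 'C(n, k).
  have [->|] := eqVneq k n./2; first by rewrite leq_mul2r leq_exp2r// orbT.
  have {}step j : j < 4 -> 15 * 'C(n, n./2 - j) <= 16 * 'C(n, n./2 - j.+1).
    by move=> j4; have -> : n./2 - j = (n./2 - j.+1).+1 by [lia]; apply: step; lia.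
  have h0 : 15 * 'C(n, n./2) <= 16 * 'C(n, n./2 - 1).
    by have := step 0 isT; rewrite subn0.
  have h1 : 15 * 'C(n, n./2 - 1) <= 16 * 'C(n, n./2 - 2) by exact: step.
  have h2 : 15 * 'C(n, n./2 - 2) <= 16 * 'C(n, n./2 - 3) by exact: step.
  have h3 : 15 * 'C(n, n./2 - 3) <= 16 * 'C(n, n./2 - 4) by exact: step.
  have -> : 15 ^ 4 = 15 * 15 * 15 * 15 by [].
  have -> : 16 ^ 4 = 16 * 16 * 16 * 16 by [].
  move=> kn.
  have K : k = n./2 - 1 \/ k = n./2 - 2 \/ k = n./2 - 3 \/ k = n./2 - 4 by lia.
  by case: K => [->|[->|[->| ->]]]; lia.
have h := @bin_half_sqr_ge n.
have {}h := h (leq_trans _ n256).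
have H2 : 15 ^ 8 * 'C(n, n./2) ^ 2 <= 16 ^ 8 * 'C(n, k) ^ 2.
  move: H; move: 15 16 => a b H.
  by rewrite (expnM a 4 2) (expnM b 4 2) -!expnMn leq_exp2r.
have {}h := h isT.
have p0 : 0 < 15 ^ 8 by rewrite expn_gt0.
have c : 2 * n.+1 * 16 ^ 8 <= 15 ^ 8 * (4 * n) by rewrite !expnS expn0; lia.
move: (15 ^ 8) (16 ^ 8) p0 c H2 h => a b p0 c H2 h.
rewrite -(leq_pmul2l p0).
have s1 := leq_mul (leqnn (2 * n.+1)) H2.
have s2 := leq_mul c (leqnn ('C(n, k) ^ 2)).
have s3 := leq_mul (leqnn a) h.
move: ('C(n, k) ^ 2) ('C(n, n./2) ^ 2) (4 ^ n) s1 s2 s3 => X Y Z s1 s2 s3.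
nia.
Qed.

End CentralBinomial.

(** * Walsh transform on the cube *)

Section WalshCharacters.
Variables (R : realFieldType) (T : finType).
Implicit Types (S A B : {set T}) (s : nat).

(** The Walsh character (-1)^|S ∩ A|, kept as a product so that sums over sets factorise over the
    points. *)
Definition chi S A : R := \prod_(j in S) (-1) ^+ (j \in A).

Lemma chiC S A : chi S A = chi A S.
Proof.
rewrite /chi big_mkcond [RHS]big_mkcond; apply: eq_bigr => j _.
by case: (j \in S); case: (j \in A).
Qed.

Lemma chi0 A : chi finset.set0 A = 1.
Proof. by rewrite /chi big_set0. Qed.

Lemma chiT A : chi finset.setT A = (-1) ^+ #|A|.
Proof.
by rewrite chiC /chi -prodr_const; apply: eq_bigr => j _; rewrite inE.
Qed.

Lemma normr_chi S A : `|chi S A| = 1.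
Proof.
rewrite /chi normr_prod big1 // => j _.
by rewrite normrX normrN1 expr1n.
Qed.

Lemma sum_prod_in (F : T -> R) :
  \sum_(S : {set T}) \prod_(j in S) F j = \prod_j (F j + 1).
Proof. by rewrite bigA_distr; apply: eq_bigr => S _; rewrite big_mkcond. Qed.

(** The sum factorises over the points j; the factor at j is 2 where A and B agree and 0 where they
    differ. *)
Lemma chi_orthogonal A B :
  \sum_S chi S A * chi S B = (2 ^ #|T|)%:R * (A == B)%:R.
Proof.
under eq_bigr do rewrite /chi -big_split/=.
rewrite sum_prod_in; have [->|AB] := eqVneq A B.
  rewrite mulr1 natrX -prodr_const; apply: eq_bigr => j _.
  by case: (j \in B); ring.
rewrite mulr0; have [j Dj] : exists j, (j \in A) != (j \in B).
  apply/existsP; apply: contraR AB; rewrite negb_exists => /forallP H.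
  by apply/eqP/setP => j; have := H j; rewrite negbK => /eqP.
rewrite (bigD1 j)//= (_ : _ + 1 = 0) ?mul0r//.
by move: Dj; case: (j \in A); case: (j \in B) => // _; ring.
Qed.

Lemma parseval (D : {set T} -> R) :
  \sum_S (\sum_A D A * chi S A) ^+ 2 = (2 ^ #|T|)%:R * \sum_A D A ^+ 2.
Proof.
transitivity (\sum_S \sum_A \sum_B D A * D B * (chi S A * chi S B)).
  apply: eq_bigr => S _; rewrite expr2 big_distrlr/=.
  by apply: eq_bigr => A _; apply: eq_bigr => B _; ring.
rewrite exchange_big mulr_sumr; apply: eq_bigr => A _ /=.
rewrite exchange_big (bigD1 A)//= -mulr_sumr chi_orthogonal eqxx mulr1 big1 => [|B AB].
  by ring.
by rewrite -mulr_sumr chi_orthogonal eq_sym (negbTE AB) !mulr0.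
Qed.

(** The binary Krawtchouk polynomial of degree s at |S|. *)
Definition level_sum S s : R := \sum_(A : {set T} | #|A| == s) chi S A.

(** Only |S| enters this generating function, which yields the permutation invariance
    [level_sum_card]. *)
Lemma level_sum_coef S s :
  level_sum S s =
  ((1 - 'X : {poly R}) ^+ #|S| * (1 + 'X) ^+ #|~: S|)`_s.
Proof.
have -> : (1 - 'X) ^+ #|S| * (1 + 'X) ^+ #|~: S| =
    \sum_(A : {set T}) chi S A *: 'X^#|A| :> {poly R}.
  rewrite -!prodr_const big_mkcond [X in _ * X]big_mkcond -big_split/=.
  transitivity (\prod_j (((-1) ^+ (j \in S)) *: 'X + 1 : {poly R})).
    apply: eq_bigr => j _; rewrite inE.
    case: (j \in S) => /=; rewrite ?mulr1 ?mul1r ?expr0 ?scale1r; last by rewrite addrC.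
    by rewrite expr1 scaleN1r addrC.
  rewrite bigA_distr; apply: eq_bigr => A _.
  rewrite -big_mkcond chiC /chi/= -prodr_const.
  by rewrite scaler_prod.
rewrite coef_sum /level_sum big_mkcond/=; apply: eq_bigr => A _.
by rewrite coefZ coefXn eq_sym; case: eqP => _; rewrite ?mulr1 ?mulr0.
Qed.

Lemma level_sum_card S S' s : #|S| = #|S'| -> level_sum S s = level_sum S' s.
Proof.
move=> e; have eC : #|~: S| = #|~: S'|.
  by apply/eqP; rewrite -(eqn_add2l #|S|) {2}e !cardsC.
by rewrite !level_sum_coef e eC.
Qed.

Lemma card_level s : #|[pred A : {set T} | #|A| == s]| = 'C(#|T|, s).
Proof. by rewrite -card_draws cardsE. Qed.

Lemma sum_level s : \sum_(A : {set T} | #|A| == s) 1 = 'C(#|T|, s)%:R :> R.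
Proof. by rewrite -card_level sumr_const. Qed.

Definition rho S s : R := level_sum S s / 'C(#|T|, s)%:R.

Lemma rho_norm S s : `|rho S s| <= 1.
Proof.
rewrite normrM normfV normr_nat.
have [->|c0] := posnP 'C(#|T|, s); first by rewrite invr0 mulr0.
rewrite ler_pdivrMr ?ltr0n// mul1r -sum_level.
apply: le_trans (ler_norm_sum _ _ _) _; apply: ler_sum => A _.
by rewrite normr_chi.
Qed.

Lemma rho0 s : (s <= #|T|)%N -> rho finset.set0 s = 1.
Proof.
move=> sT; rewrite /rho /level_sum; under eq_bigr do rewrite chi0.
by rewrite sum_level divff// pnatr_eq0 -lt0n bin_gt0.
Qed.

Lemma rhoT s : (s <= #|T|)%N -> rho finset.setT s = (-1) ^+ s.
Proof.
move=> sT; rewrite /rho /level_sum.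
rewrite (eq_bigr (fun=> (-1) ^+ s * 1)) => [|A /eqP As]; last by rewrite chiT As mulr1.
by rewrite -mulr_sumr sum_level mulfK// pnatr_eq0 -lt0n bin_gt0.
Qed.

Lemma sum_rho_sqr s : (s <= #|T|)%N ->
  \sum_S rho S s ^+ 2 = (2 ^ #|T|)%:R / 'C(#|T|, s)%:R.
Proof.
move=> sT; have c0 : 'C(#|T|, s)%:R != 0 :> R by rewrite pnatr_eq0 -lt0n bin_gt0.
have P : \sum_S level_sum S s ^+ 2 = (2 ^ #|T|)%:R * 'C(#|T|, s)%:R.
  have E S : \sum_(A : {set T}) (#|A| == s)%:R * chi S A = level_sum S s.
    rewrite /level_sum [RHS]big_mkcond; apply: eq_bigr => A _.
    by case: eqP => _; rewrite ?mul1r ?mul0r.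
  transitivity (\sum_S (\sum_(A : {set T}) (#|A| == s)%:R * chi S A) ^+ 2).
    by apply: eq_bigr => S _; rewrite E.
  rewrite parseval -sum_level [in RHS]big_mkcond; congr (_ * _).
  by apply: eq_bigr => A _; case: eqP => _; rewrite ?expr1n ?expr0n.
rewrite /rho; under eq_bigr do rewrite expr_div_n.
by rewrite -mulr_suml P; field.
Qed.

(** In the Parseval sum [sum_rho_sqr] only the sets of the size of S are kept; all of them
    contribute the same square. *)
Lemma rho_sqr_le S s : (s <= #|T|)%N ->
  rho S s ^+ 2 * 'C(#|T|, #|S|)%:R <= (2 ^ #|T|)%:R / 'C(#|T|, s)%:R.
Proof.
move=> sT; rewrite -sum_rho_sqr// [leRHS](bigID (fun S' => #|S'| == #|S|))/=.
rewrite -[leLHS]addr0 lerD//; last by apply: sumr_ge0 => S' _; rewrite sqr_ge0.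
rewrite -sum_level mulr_sumr; apply: ler_sum => S' /eqP e.
by rewrite mulr1 /rho (level_sum_card s e).
Qed.

End WalshCharacters.

(** * The normal distribution and its Stein equation *)

Lemma MVT_is_derive (R : realType) (F dF : R -> R) (a b : R) : a <= b ->
  (forall t : R, is_derive t 1 F (dF t)) ->
  exists2 c, a <= c <= b & F b - F a = dF c * (b - a).
Proof.
move=> ab H; have [|c] := MVT_segment ab (fun t _ => H t).
  by apply: derivable_within_continuous => t _; exact: ex_derive.
by rewrite in_itv; exists c.
Qed.

Section StandardNormal.
Local Open Scope classical_set_scope.
Local Open Scope ring_scope.
Context {R : realType}.
Implicit Types w x z t d c : R.

Local Notation phi := (@normal_pdf R 0 1).

Lemma phiE x : phi x = normal_peak 1 * expR (- x ^+ 2 / 2).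
Proof. by rewrite normal_pdfE ?oner_neq0// /normal_fun subr0 expr1n. Qed.

Lemma phi_gt0 x : 0 < phi x.
Proof. by rewrite phiE mulr_gt0 ?expR_gt0// normal_peak_gt0 ?oner_neq0. Qed.

Lemma is_derive_phi x : is_derive x 1 phi (- x * phi x).
Proof.
have -> : phi = fun x => normal_peak 1 * expR (- x ^+ 2 / 2) :> R.
  by apply/funext => y; rewrite phiE.
by apply: is_derive_eq; rewrite /GRing.scale/= ; field.
Qed.

Lemma Phi_ge0 x : 0 <= Phi x.
Proof. by rewrite fine_ge0. Qed.

Lemma Phi_le1 x : Phi x <= 1.
Proof.
rewrite -lee_fin fineK; first exact: probability_le1.
exact: fin_num_measure.
Qed.

Lemma is_derive_Phi x : is_derive x 1 Phi (phi x).
Proof.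
have xu : x < x + 1 by rewrite ltrDl.
have intf : lebesgue_measure.-integrable `]-oo, (x + 1)]
    (EFin \o phi).
  by apply: (integrableS _ _ (subsetT _)) => //; exact: integrable_normal_pdf.
have [] := continuous_FTC1 xu intf (ltNyr _)
  (@continuous_normal_pdf R 0 1 (oner_neq0 _) x).
rewrite derive1E => dF <-; exact/derivableP.
Qed.

(** Under the standard normal law the identity is a random variable with distribution function
    [Phi], so the limits of [Phi] are those of a distribution function. *)
Let idTR : measurableTypeR R -> R := idfun.

HB.instance Definition _ :=
  @isMeasurableFun.Build _ _ _ _ idTR (@measurable_id _ _ setT).

Lemma cvg_PhiNy : Phi x @[x --> -oo] --> (0 : R).
Proof.
have := cvg_cdfNy0 (idTR : {RV (normal_prob (0 : R) 1) >-> R}).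
move=> /fine_cvgP[_]; exact.
Qed.

Lemma cvg_Phiy : Phi x @[x --> +oo] --> (1 : R).
Proof.
have := cvg_cdfy1 (idTR : {RV (normal_prob (0 : R) 1) >-> R}).
move=> /fine_cvgP[_]; exact.
Qed.


(** [Phi x + Phi (- x)] has derivative zero, and its constant value is its limit 1 at infinity. *)
Lemma PhiN x : Phi (- x) = 1 - Phi x.
Proof.
pose S x := Phi x + Phi (- x) : R.
have dS t : is_derive t 1 S 0.
  have h1 := is_derive_Phi t; have h2 := is_derive_Phi (- t).
  have h3 : is_derive t 1 (Phi \o -%R) (- phi t).
    apply: (@is_derive_eq _ _ _ _ _ _ _ _ (is_derive1_comp _ _)).
    by rewrite /GRing.scale/= mulrN1 !phiE sqrrN.
  have -> : S = Phi + (Phi \o -%R) by [].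
  by apply: is_derive_eq; rewrite subrr.
suff : S x = 1 by rewrite /S => <-; ring.
have Scst : S = fun=> S x by apply/funext => t; exact: is_derive_0_is_cst.
have S1 : S t @[t --> +oo] --> (1 + 0 : R).
  apply: cvgD; first exact: cvg_Phiy.
  by have := @cvg_PhiNy; rewrite cvgNy_compNP.
rewrite addr0 Scst in S1.
by apply: (cvg_unique _ _ S1) => //; exact: cvg_cst.
Qed.

(* The derivative of [t |-> phi t + w * Phi t] is [(w - t) * phi t], so this
   map increases up to [w] from its limit [0] at [-oo]. *)
Lemma phi_mills w : - w * Phi w <= phi w.
Proof.
have H a : a < w -> w * Phi a <= phi w + w * Phi w.
  move=> aw.
  have dK t : is_derive t 1 (fun t => phi t + w * Phi t) ((w - t) * phi t).
    have h1 := is_derive_Phi t; have h2 := is_derive_phi t.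
    by apply: is_derive_eq; rewrite /GRing.scale/=; ring.
  have [c /andP[ac cw] E] := MVT_is_derive (ltW aw) dK.
  have : 0 <= (w - c) * phi c * (w - a).
    by rewrite !mulr_ge0 ?subr_ge0 ?(ltW (phi_gt0 _))// ltW.
  rewrite -E; have := phi_gt0 a; lra.
suff : w * 0 <= phi w + w * Phi w by lra.
have C : w * Phi a @[a --> -oo] --> w * 0.
  by apply: cvgMr; exact: cvg_PhiNy.
apply: (cvgr_to_le C).
near=> a; apply: H; near: a; apply: nbhs_ninfty_lt; exact: num_real.
Unshelve. all: by end_near. Qed.

Lemma phi_mills_compl w : w * (1 - Phi w) <= phi w.
Proof.
by have := phi_mills (- w); rewrite opprK PhiN !phiE sqrrN.
Qed.


Lemma sqrt2pi_lt3 : Num.sqrt (2 * pi) < 3 :> R.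
Proof.
rewrite -(ltr_pXn2r (n := 2)) ?nnegrE ?sqrtr_ge0// sqr_sqrtr.
  by have := @pihalf_lt2 R; lra.
by rewrite mulr_ge0 ?pi_ge0.
Qed.

Lemma phi_ge w : `|w| <= 1 -> 6^-1 <= phi w.
Proof.
move=> w1; rewrite phiE.
have peak3 : 3^-1 <= @normal_peak R 1.
  have -> : @normal_peak R 1 = (Num.sqrt (2 * pi))^-1.
    by rewrite /normal_peak expr1n mul1r -(mulr_natl pi).
  rewrite lef_pV2 ?posrE ?ltr0n ?sqrtr_gt0 ?mulr_gt0 ?pi_gt0//.
  exact: ltW sqrt2pi_lt3.
have e2 : 2^-1 <= expR (- w ^+ 2 / 2).
  apply: le_trans (expR_ge1Dx _).
  have : w ^+ 2 <= 1 by rewrite -(real_normK (num_real w)) exprn_ile1.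
  lra.
have -> : 6^-1 = 3^-1 * 2^-1 :> R by rewrite -invfM -natrM.
by apply: ler_pM => //; rewrite invr_ge0.
Qed.

(** The value at w of the Stein solution with kink at w. It dominates the value at w of the solution
    for every other z, on either branch. *)
Let mills_prod w : R := Phi w * (1 - Phi w) / phi w.

Lemma norm_mul_mills_prod w : `|w| * mills_prod w <= 1.
Proof.
have P0 := Phi_ge0 w; have P1 := Phi_le1 w.
rewrite mulrA ler_pdivrMr ?phi_gt0// mul1r.
case: (lerP 0 w) => w0.
- rewrite ger0_norm// mulrCA; apply: le_trans (phi_mills_compl w).
  by rewrite ler_piMl// mulr_ge0 ?subr_ge0.
- rewrite ltr0_norm// mulrA; apply: le_trans (phi_mills w).
  by rewrite ler_piMr ?mulr_ge0//; [lra|rewrite gerBl].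
Qed.

(** For |w| <= 1 the bounds Phi (1 - Phi) <= 1/4 and phi >= 1/6 give 3/2; for |w| > 1 the quantity
    is below |w| times itself, hence at most 1. *)
Lemma mills_prod_le2 w : mills_prod w <= 2.
Proof.
case: (lerP `|w| 1) => w1.
  rewrite ler_pdivrMr ?phi_gt0//; have := phi_ge w1.
  have : Phi w * (1 - Phi w) <= 4^-1 by have := sqr_ge0 (Phi w - 2^-1); lra.
  lra.
have B0 : 0 <= mills_prod w.
  by rewrite divr_ge0 ?(ltW (phi_gt0 _))// mulr_ge0 ?Phi_ge0// subr_ge0 Phi_le1.
apply: le_trans (le_trans (norm_mul_mills_prod w) _); last by lra.
by rewrite ler_peMl// ltW.
Qed.

(* The two branches, left and right of [z], of the solution of Stein's
   equation [f' w - w * f w = (w <= z) - Phi z]. *)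
Definition stein_left z w := (1 - Phi z) * (Phi w / phi w).
Definition stein_right z w := Phi z * ((1 - Phi w) / phi w).
Definition stein_sol z w := if w <= z then stein_left z w else stein_right z w.

Lemma is_derive_stein_left z w :
  is_derive w 1 (stein_left z) (w * stein_left z w + (1 - Phi z)).
Proof.
have h1 := is_derive_Phi w; have h2 := is_derive_phi w.
have p0 : phi w != 0 by rewrite gt_eqF ?phi_gt0.
have h3 := is_deriveV p0 h2.
have -> : stein_left z = cst (1 - Phi z) * (Phi * (fun y => (phi y)^-1)) by [].
by apply: is_derive_eq; rewrite !fctE /GRing.scale/=; field.
Qed.

Lemma is_derive_stein_right z w :
  is_derive w 1 (stein_right z) (w * stein_right z w + - Phi z).
Proof.
have h1 := is_derive_Phi w; have h2 := is_derive_phi w.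
have p0 : phi w != 0 by rewrite gt_eqF ?phi_gt0.
have h3 := is_deriveV p0 h2.
have -> : stein_right z =
  cst (Phi z) * ((cst 1 - Phi) * (fun y => (phi y)^-1)) by [].
by apply: is_derive_eq; rewrite !fctE /GRing.scale/=; field.
Qed.

Lemma stein_left_right z : stein_left z z = stein_right z z.
Proof. by rewrite /stein_left /stein_right; ring. Qed.

Lemma Phi_nondecreasing w v : w <= v -> Phi w <= Phi v.
Proof.
move=> wv; have [c _ E] := MVT_is_derive wv is_derive_Phi.
by rewrite -subr_ge0 E mulr_ge0 ?(ltW (phi_gt0 _))// subr_ge0.
Qed.

Lemma stein_left_bounds z w : w <= z ->
  `|stein_left z w| <= 2 /\ `|w * stein_left z w| <= 1.
Proof.
move=> wz; have Pz := Phi_nondecreasing wz.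
have P0 := Phi_ge0 w; have P1 := Phi_le1 z; have p0 := phi_gt0 w.
have f0 : 0 <= stein_left z w by rewrite mulr_ge0 ?divr_ge0 ?subr_ge0// ltW.
have fB : stein_left z w <= mills_prod w.
  rewrite /stein_left /mills_prod mulrA ler_pM2r ?invr_gt0// mulrC.
  by apply: ler_wpM2l => //; lra.
rewrite (normrM w) (ger0_norm f0); split.
  exact: le_trans fB (mills_prod_le2 _).
exact: le_trans (ler_wpM2l (normr_ge0 _) fB) (norm_mul_mills_prod _).
Qed.

Lemma stein_right_bounds z w : z <= w ->
  `|stein_right z w| <= 2 /\ `|w * stein_right z w| <= 1.
Proof.
move=> zw; have Pz := Phi_nondecreasing zw.
have P0 := Phi_ge0 z; have P1 := Phi_le1 w; have p0 := phi_gt0 w.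
have f0 : 0 <= stein_right z w by rewrite mulr_ge0 ?divr_ge0 ?subr_ge0// ltW.
have fB : stein_right z w <= mills_prod w.
  rewrite /stein_right /mills_prod mulrA ler_pM2r ?invr_gt0//.
  by apply: ler_wpM2r => //; lra.
rewrite (normrM w) (ger0_norm f0); split.
  exact: le_trans fB (mills_prod_le2 _).
exact: le_trans (ler_wpM2l (normr_ge0 _) fB) (norm_mul_mills_prod _).
Qed.

(** The mean value theorem is used twice: the difference quotient is F'(u) for some u, and F'(u) -
    F'(x) is an increment of t F(t), whose derivative F + t F' is at most 2 + 2(|w| + d) in size.
    The branches have c = 1 - Phi z and c = - Phi z. *)
Lemma stein_ode_increment (F : R -> R) c w d : 0 < d -> `|c| <= 1 ->
  (forall t, is_derive t 1 F (t * F t + c)) ->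
  (forall t, w <= t <= w + d -> `|F t| <= 2 /\ `|t * F t| <= 1) ->
  `|F (w + d) - F w| <= 2 * d /\
  (forall x, w <= x <= w + d ->
     `|(F (w + d) - F w) / d - (x * F x + c)| <= d * (2 + 2 * (`|w| + d))).
Proof.
move=> d0 c1 dF bF; have wd : w < w + d by rewrite ltrDl.
have dF2 t : w <= t <= w + d -> `|t * F t + c| <= 2.
  by move=> /bF[_ b]; have := ler_normD (t * F t) c; lra.
have [u /andP[wu ud] E] := MVT_is_derive (ltW wd) dF.
have wd0 : w + d - w = d by ring.
rewrite wd0 in E; rewrite E; split.
  by rewrite normrM (gtr0_norm d0) ler_pM2r// dF2// wu.
move=> x /andP[wx xd]; rewrite mulfK ?gt_eqF//.
pose G t := t * F t.
have dG t : is_derive t 1 G (F t + t * (t * F t + c)).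
  have h := dF t; have -> : G = id * F by [].
  by apply: is_derive_eq; rewrite /GRing.scale/=; ring.
have bG t : w <= t <= w + d -> `|F t + t * (t * F t + c)| <= 2 + 2 * (`|w| + d).
  move=> /[dup] /dF2 b /[dup] /bF[b' _] /andP[wt td].
  apply: le_trans (ler_normD _ _) _; apply: lerD => //.
  rewrite normrM mulrC ler_pM//.
  have := ler_normD w (t - w); rewrite addrC subrK => /le_trans; apply.
  by rewrite lerD2l ger0_norm; lra.
suff L a b : w <= a -> a <= b -> b <= w + d ->
    `|G b - G a| <= d * (2 + 2 * (`|w| + d)).
  rewrite (_ : u * F u + c - (x * F x + c) = G u - G x); last by rewrite /G; ring.
  by case: (lerP x u) => [xu|/ltW ux]; [|rewrite distrC]; apply: L.
move=> wa ab bd; have [y /andP[ay yb] ->] := MVT_is_derive ab dG.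
have {}ay : w <= y by exact: le_trans ay.
have {}yb : y <= w + d by exact: le_trans yb _.
rewrite normrM mulrC ler_pM ?bG ?ay// ger0_norm; lra.
Qed.

(** The derivative of [stein_sol z] read off Stein's equation; at the kink w = z it is the left
    derivative. *)
Definition stein_deriv z w := w * stein_sol z w + (w <= z)%R%:R - Phi z.

Lemma stein_deriv_le2 z w : `|stein_deriv z w| <= 2.
Proof.
have P0 := Phi_ge0 z; have P1 := Phi_le1 z.
rewrite /stein_deriv /stein_sol; case: (lerP w z) => wz.
  have [_ b] := stein_left_bounds wz.
  rewrite -addrA; apply: le_trans (ler_normD _ _) _.
  by rewrite (ger0_norm (_ : 0 <= 1 - Phi z)); lra.
have [_ b] := stein_right_bounds (ltW wz).
rewrite addr0; apply: le_trans (ler_normB _ _) _; rewrite (ger0_norm P0); lra.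
Qed.

Let PhiC_norm z : `|1 - Phi z : R| <= 1.
Proof. by rewrite ger0_norm ?subr_ge0 ?Phi_le1// gerBl Phi_ge0. Qed.

Let PhiN_norm z : `|- Phi z : R| <= 1.
Proof. by rewrite normrN ger0_norm ?Phi_le1 ?Phi_ge0. Qed.

Let stein_left_increment z w d : 0 < d -> w + d <= z ->
  `|stein_left z (w + d) - stein_left z w| <= 2 * d /\
  (forall x, w <= x <= w + d ->
     `|(stein_left z (w + d) - stein_left z w) / d - stein_deriv z x| <=
       d * (2 + 2 * (`|w| + d))).
Proof.
move=> d0 wz; have [|H1 H2] := stein_ode_increment d0
  (PhiC_norm z) (is_derive_stein_left z) (w := w).
  by move=> t /andP[_ td]; apply: stein_left_bounds; exact: le_trans wz.
split=> // x /[dup] /andP[_ xd] /H2.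
by rewrite addrA /stein_deriv /stein_sol (le_trans xd wz).
Qed.

Let stein_right_increment z w d : 0 < d -> z <= w ->
  `|stein_right z (w + d) - stein_right z w| <= 2 * d /\
  (forall x, z < x -> w <= x <= w + d ->
     `|(stein_right z (w + d) - stein_right z w) / d - stein_deriv z x| <=
       d * (2 + 2 * (`|w| + d))).
Proof.
move=> d0 zw; have [|H1 H2] := stein_ode_increment d0
  (PhiN_norm z) (is_derive_stein_right z) (w := w).
  by move=> t /andP[wt _]; apply: stein_right_bounds; exact: le_trans wt.
split=> // x zx /H2.
by rewrite /stein_deriv /stein_sol (leNgt x) zx/= addr0.
Qed.

Lemma stein_sol_increment z w d : 0 < d ->
  `|stein_sol z (w + d) - stein_sol z w| <= 2 * d.
Proof.
move=> d0; rewrite /stein_sol.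
have [wz|zw] := lerP w z; have [wdz|zwd] := lerP (w + d) z.
- by have [] := stein_left_increment d0 wdz.
(* The interval straddles z: the increments of the two branches are added at z, where the branches
   agree. *)
- have [->|wz'] := eqVneq w z.
    by rewrite stein_left_right; have [] := stein_right_increment d0 (lexx z).
  have zw0 : 0 < z - w by rewrite subr_gt0 lt_neqAle wz' wz.
  have wd0 : 0 < w + d - z by rewrite subr_gt0.
  have wzz : w + (z - w) = z by ring.
  have zwz : z + (w + d - z) = w + d by ring.
  have [|h1 _] := @stein_left_increment z w (z - w) zw0; first by rewrite wzz.
  have [h2 _] := @stein_right_increment z z (w + d - z) wd0 (lexx z).
  rewrite wzz stein_left_right in h1; rewrite zwz in h2.
  have := ler_normD (stein_right z (w + d) - stein_right z z)
    (stein_right z z - stein_left z w).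
  by rewrite addrA subrK; lra.
- by lra.
- by have [] := stein_right_increment d0 (ltW zw).
Qed.

(** Unless z lies in the half-open cell, the interval stays on one branch; the case w + d = z
    belongs to the left branch, in accordance with the left derivative at the kink. *)
Lemma stein_sol_slope z w d : 0 < d -> ~~ (w <= z < w + d) ->
  let A := (stein_sol z (w + d) - stein_sol z w) / d in
  `|A - stein_deriv z w| <= d * (2 + 2 * (`|w| + d)) /\
  `|A - stein_deriv z (w + d)| <= d * (2 + 2 * (`|w| + d)).
Proof.
move=> d0; have wd : w < w + d by rewrite ltrDl.
have w1 : w <= w <= w + d by rewrite lexx ltW.
have w2 : w <= w + d <= w + d by rewrite lexx ltW.
rewrite negb_and -ltNge -leNgt => /orP[zw|wdz] A; rewrite {}/A /stein_sol.
- have [_ H] := stein_right_increment d0 (ltW zw).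
  have zwd : z < w + d by exact: lt_trans wd.
  by rewrite (leNgt w) (leNgt (w + d)) zw zwd/=; split; apply: H.
- have [_ H] := stein_left_increment d0 wdz.
  by rewrite wdz (le_trans (ltW wd) wdz)/=; split; apply: H.
Qed.

End StandardNormal.

(** * Berry-Esseen bound for the symmetric binomial law *)

Section BinomialSums.
Context {R : realType}.
Implicit Types (u : nat -> R) (n p k : nat).

(** This identity and [sum_bin_mulrB] pass from Bin(p+1, 1/2) to Bin(p, 1/2); their sum is Pascal's
    rule and their difference is [sum_bin_stein]. *)
Lemma sum_bin_mulr u p :
  \sum_(k < p.+2) 'C(p.+1, k)%:R * (k%:R * u k) =
  p.+1%:R * \sum_(k < p.+1) 'C(p, k)%:R * u k.+1.
Proof.
rewrite big_ord_recl mul0r mulr0 add0r big_distrr/=.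
apply: eq_bigr => k _; rewrite /bump/= add1n !mulrA; congr (_ * _).
by rewrite mulrC -(natrM R k.+1) -(natrM R p.+1) -mul_bin_diag.
Qed.

Lemma sum_bin_mulrB u p :
  \sum_(k < p.+2) 'C(p.+1, k)%:R * ((p.+1%:R - k%:R) * u k) =
  p.+1%:R * \sum_(k < p.+1) 'C(p, k)%:R * u k.
Proof.
rewrite big_ord_recr/= subrr mul0r mulr0 addr0 big_distrr/=.
apply: eq_bigr => k _; rewrite !mulrA; congr (_ * _).
rewrite mulrC -(natrB _ (ltnW (ltn_ord k))) -(natrM R (p.+1 - k)).
by rewrite -(natrM R p.+1) (mul_bin_down p.+1).
Qed.

Lemma sum_bin_pascal u p :
  \sum_(k < p.+2) 'C(p.+1, k)%:R * u k =
  \sum_(k < p.+1) 'C(p, k)%:R * (u k + u k.+1).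
Proof.
have p0 : p.+1%:R != 0 :> R by rewrite pnatr_eq0.
apply: (mulfI p0); under [in RHS]eq_bigr do rewrite mulrDr.
rewrite big_split mulrDr/= -sum_bin_mulr -sum_bin_mulrB -big_split mulr_sumr/=.
by apply: eq_bigr => k _; ring.
Qed.

(* The discrete counterpart of Gaussian integration by parts. *)
Lemma sum_bin_stein u p :
  \sum_(k < p.+2) 'C(p.+1, k)%:R * ((2 * k%:R - p.+1%:R) * u k) =
  p.+1%:R * \sum_(k < p.+1) 'C(p, k)%:R * (u k.+1 - u k).
Proof.
under [in RHS]eq_bigr do rewrite mulrBr.
rewrite sumrB mulrBr/= -sum_bin_mulr -sum_bin_mulrB -sumrB/=.
by apply: eq_bigr => k _; ring.
Qed.

Lemma sum_bin n : \sum_(k < n.+1) 'C(n, k)%:R = 2 ^+ n :> R.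
Proof.
rewrite (exprDn 1 1); apply: eq_bigr => k _.
by rewrite !expr1n mulr1.
Qed.

Lemma sum_bin_center n : \sum_(k < n.+1) 'C(n, k)%:R * (2 * k%:R - n%:R) = 0 :> R.
Proof.
case: n => [|p]; first by rewrite big_ord1 mulr0 subrr mulr0.
have := sum_bin_stein (fun=> 1) p; under eq_bigr do rewrite mulr1.
by move=> ->; rewrite big1 ?mulr0// => k _; rewrite subrr mulr0.
Qed.

Lemma sum_bin_variance n :
  \sum_(k < n.+1) 'C(n, k)%:R * (2 * k%:R - n%:R) ^+ 2 = n%:R * 2 ^+ n :> R.
Proof.
case: n => [|p]; first by rewrite big_ord1 mulr0 subrr mul0r expr0n mulr0.
have := sum_bin_stein (fun k => 2 * k%:R - p.+1%:R) p => /= ->.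
rewrite exprS -sum_bin; congr (_ * _); rewrite mulr_sumr.
by apply: eq_bigr => k _; rewrite -(natr1 k); ring.
Qed.

(** Later sums run over Bin(p, 1/2) but are centred at (p+1)/2; the displaced centre adds 1 to the
    variance p. *)
Lemma sum_bin_variance_shift p :
  \sum_(k < p.+1) 'C(p, k)%:R * (2 * k%:R - p.+1%:R) ^+ 2 =
  p.+1%:R * 2 ^+ p :> R.
Proof.
transitivity (\sum_(k < p.+1) ('C(p, k)%:R * (2 * k%:R - p%:R) ^+ 2 +
    (- 2 * ('C(p, k)%:R * (2 * k%:R - p%:R)) + 'C(p, k)%:R)) : R).
  by apply: eq_bigr => k _; rewrite -(natr1 p); ring.
rewrite !big_split/= -mulr_sumr sum_bin_variance sum_bin_center sum_bin.
by rewrite -(natr1 p); ring.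
Qed.

Lemma bin_mass_le n k : 'C(n, k)%:R / 2 ^+ n <= (Num.sqrt n.+1%:R)^-1 :> R.
Proof.
rewrite -(ler_pXn2r (n := 2)) ?nnegrE ?invr_ge0 ?sqrtr_ge0 ?divr_ge0 ?exprn_ge0//.
rewrite exprVn sqr_sqrtr// expr_div_n -exprM mulnC exprM.
rewrite ler_pdivrMr ?exprn_gt0// mulrC ler_pdivlMr ?ltr0n//.
have -> : 2 ^+ 2 = 4%:R :> R by rewrite -natrX.
by rewrite -!natrX -natrM ler_nat bin_sqr_le.
Qed.

End BinomialSums.

(** * Stein's method for the symmetric binomial law *)

Definition bin_cdf {R : realType} (n : nat) (sig z : R) : R :=
  (\sum_(k < n.+1 | ((k%:R - n%:R / 2) / sig <= z)%R) 'C(n, k)%:R) / 2 ^+ n.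

Section BinomialBerryEsseen.
Context {R : realType}.
Variables (p : nat) (sig z : R).
Hypothesis sig0 : 0 < sig.

Let n := p.+1.
Let w (k : nat) : R := (k%:R - n%:R / 2) / sig.
Let d := sig^-1.
(** The ratio of the binomial variance n/4 to the squared scale. *)
Let kap := n%:R / (4 * sig ^+ 2).
Let f (k : nat) := stein_sol z (w k).
Let g (k : nat) := stein_deriv z (w k).
Let A (k : nat) := (f k.+1 - f k) / d.
Let hit (k : nat) := w k <= z < w k.+1.

Let d0 : 0 < d. Proof. by rewrite invr_gt0. Qed.

Let wS k : w k.+1 = w k + d.
Proof. by rewrite /w /d -(natr1 k); field; rewrite gt_eqF. Qed.

(** Stein's equation gives E g - E[w f]. Pascal's rule rewrites E g over Bin(p, 1/2), and
    [sum_bin_stein] turns E[w f] into the difference quotients [A]. *)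
Let bin_cdf_stein : bin_cdf n sig z - Phi z =
  (\sum_(k < p.+1) 'C(p, k)%:R * (g k + g k.+1 - 2 * kap * A k)) / 2 ^+ n.
Proof.
have n20 : 2 ^+ n != 0 :> R by rewrite expf_neq0.
apply: (mulIf n20); rewrite mulrBl !divfK// -sum_bin.
rewrite big_mkcond mulr_sumr -sumrB/=.
transitivity (\sum_(k < n.+1) 'C(n, k)%:R * g k -
              \sum_(k < n.+1) 'C(n, k)%:R * (w k * f k)).
  rewrite -sumrB; apply: eq_bigr => k _.
  rewrite /g /stein_deriv -/(f k) -/(w k).
  by case: ifP => _ /=; ring.
rewrite sum_bin_pascal.
have -> : \sum_(k < n.+1) 'C(n, k)%:R * (w k * f k) =
    (2 * sig)^-1 * \sum_(k < n.+1) 'C(n, k)%:R * ((2 * k%:R - n%:R) * f k).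
  rewrite mulr_sumr; apply: eq_bigr => k _.
  by rewrite /w; field; rewrite gt_eqF.
rewrite sum_bin_stein mulrA mulr_sumr -sumrB; apply: eq_bigr => k _.
by rewrite /kap /A /d -/n; field; rewrite gt_eqF.
Qed.

(** The term splits as -(A k - g k) - (A k - g (k+1)) + 2 (1 - kap) A k. Away from the cell
    containing z, [stein_sol_slope] controls the first two parts; on that cell each is at most 4. *)
Let term_le k : `|g k + g k.+1 - 2 * kap * A k| <=
  2 * (d * (2 + 2 * (`|w k| + d))) + 4 * `|1 - kap| + 8 * (hit k)%:R.
Proof.
have hA : `|A k| <= 2.
  rewrite normrM normfV (gtr0_norm d0) ler_pdivrMr// /f wS.
  exact: stein_sol_increment.
suff : `|A k - g k| + `|A k - g k.+1| <=
    2 * (d * (2 + 2 * (`|w k| + d))) + 8 * (hit k)%:R.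
  have -> : g k + g k.+1 - 2 * kap * A k =
    - (A k - g k) + - (A k - g k.+1) + 2 * (1 - kap) * A k by ring.
  have h1 := ler_normD (- (A k - g k) + - (A k - g k.+1)) (2 * (1 - kap) * A k).
  have h2 := ler_normD (- (A k - g k)) (- (A k - g k.+1)).
  rewrite !normrN in h2.
  have : `|2 * (1 - kap) * A k| <= 4 * `|1 - kap|.
    rewrite (normrM (2 * (1 - kap))) (normrM 2) normr_nat.
    by have := ler_wpM2l (normr_ge0 (1 - kap)) hA; lra.
  move: h1 h2; set a := `|_ + _ + _|; lra.
have b0 : 0 <= d * (2 + 2 * (`|w k| + d)).
  by rewrite mulr_ge0 ?(ltW d0)//; have := d0; have := normr_ge0 (w k); lra.
case: (boolP (hit k)) => h /=; last first.
  move: h; rewrite /hit wS => h.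
  have [] := stein_sol_slope d0 h; rewrite -wS; rewrite -/(A k) -/(g k).
  by rewrite /A /f /g; lra.
have g1 : `|g k| <= 2 := stein_deriv_le2 _ _.
have g2 : `|g k.+1| <= 2 := stein_deriv_le2 _ _.
have := ler_normB (A k) (g k); have := ler_normB (A k) (g k.+1); lra.
Qed.

(** The cells are disjoint, so at most one k contributes, and its mass is bounded by
    [bin_mass_le]. *)
Lemma sum_bin_crossing_le :
  \sum_(k < p.+1) 'C(p, k)%:R * (w k <= z < w k.+1)%R%:R <=
  2 ^+ p * (Num.sqrt n%:R)^-1 :> R.
Proof.
rewrite -[X in X <= _]/(\sum_(k < p.+1) 'C(p, k)%:R * (hit k)%:R).
have hit_uniq j k : hit j -> hit k -> (j <= k)%N.
  move=> /andP[jz _] /andP[_ zk]; rewrite leqNgt; apply/negP => kj.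
  have : w k.+1 <= w j.
    by rewrite /w ler_pM2r ?invr_gt0// lerD2r ler_nat.
  move: jz zk; rewrite -/(w j) -/(w k.+1); lra.
case: (pickP (fun k : 'I_p.+1 => hit k)) => [k0 h0|no]; last first.
  rewrite big1 ?mulr_ge0 ?invr_ge0 ?exprn_ge0// => k _.
  by rewrite (negbTE (negbT (no k))) mulr0.
rewrite (bigD1 k0)//= h0 mulr1 big1 ?addr0 => [|k kk0].
  by rewrite mulrC -ler_pdivrMr ?exprn_gt0// bin_mass_le.
case: (boolP (hit k)) => [hk|_]; last by rewrite mulr0.
case/eqP: kk0; apply/val_inj/eqP.
by rewrite eqn_leq !hit_uniq.
Qed.

Let sum_norm_le :
  \sum_(k < p.+1) 'C(p, k)%:R * `|w k| <= 2 ^+ p * ((1 + kap) / 2).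
Proof.
(* The inequality |w| <= (1 + w^2) / 2 reduces the first moment to the second. *)
apply: (@le_trans _ _ (\sum_(k < p.+1) (2^-1 * 'C(p, k)%:R +
    (8 * sig ^+ 2)^-1 * ('C(p, k)%:R * (2 * k%:R - n%:R) ^+ 2)))).
  apply: ler_sum => k _.
  have -> : 2^-1 * 'C(p, k)%:R +
      (8 * sig ^+ 2)^-1 * ('C(p, k)%:R * (2 * k%:R - n%:R) ^+ 2) =
      'C(p, k)%:R * ((1 + w k ^+ 2) / 2).
    by rewrite /w; field; rewrite gt_eqF.
  apply: ler_wpM2l => //.
  have := sqr_ge0 (`|w k| - 1); rewrite sqrrB real_normK ?num_real//.
  by rewrite expr1n mulr1 mulr2n; lra.
rewrite big_split/= -!mulr_sumr sum_bin sum_bin_variance_shift -/n.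
by rewrite le_eqVlt; apply/orP; left; apply/eqP; rewrite /kap; field; rewrite gt_eqF.
Qed.

Theorem bin_cdf_berry_esseen :
  `|bin_cdf n sig z - Phi z| <=
  d * (3 + kap + 2 * d) + 2 * `|1 - kap| + 4 * (Num.sqrt n%:R)^-1.
Proof.
have p20 : 0 < 2 ^+ p :> R by rewrite exprn_gt0.
rewrite bin_cdf_stein normrM normfV (ger0_norm (exprn_ge0 _ _))//.
rewrite ler_pdivrMr ?exprn_gt0// /n exprS -/n.
pose c := 2 * d * (2 + 2 * d) + 4 * `|1 - kap|.
apply: (@le_trans _ _ (\sum_(k < p.+1) (c * 'C(p, k)%:R +
    4 * d * ('C(p, k)%:R * `|w k|) + 8 * ('C(p, k)%:R * (hit k)%:R)))).
  apply: le_trans (ler_norm_sum _ _ _) _; apply: ler_sum => k _.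
  rewrite normrM normr_nat.
  apply: le_trans (ler_wpM2l (ler0n _ _) (term_le k)) _.
  by rewrite le_eqVlt; apply/orP; left; apply/eqP; rewrite /c; ring.
rewrite !big_split/= -!mulr_sumr sum_bin.
have h1 := ler_wpM2l (ltW d0) sum_norm_le.
have h2 := sum_bin_crossing_le; rewrite /c; move: h2; set q := (Num.sqrt _)^-1 => h2.
set S := \sum_(_ < _) _ * `|_| in h1 *; set T := \sum_(_ < _) _ * _%:R in h2 *.
rewrite [leRHS](_ : _ = (2 * d * (2 + 2 * d) + 4 * `|1 - kap|) * 2 ^+ p +
  4 * (d * (2 ^+ p * ((1 + kap) / 2))) + 8 * (2 ^+ p * q)); last by field.
lra.
Qed.

End BinomialBerryEsseen.

(** * The law of the lightbulb process *)

Section LawOfProcess.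
Context {R : realType}.
Variables (n k : nat) (s : 'I_k -> nat).
Implicit Types (S A : {set 'I_n}) (e : switch_config n k).

Definition final e : {set 'I_n} := [set j | bulb_on e j].

Lemma XsE e : Xs e = #|final e|.
Proof.
by rewrite /Xs -sum1_card [RHS]big_mkcond; apply: eq_bigr => j _; rewrite inE; case: bulb_on.
Qed.

Definition final_law A : R := \sum_(e | final e == A) config_prob s e.

Lemma config_probE e :
  config_prob s e =
  \prod_(r < k) (if #|e r| == s r then ('C(n, s r)%:R)^-1 else 0) :> R.
Proof.
rewrite /config_prob /admissible; case: (boolP [forall r, _]) => [/forallP H|].
  by apply: eq_bigr => r _; rewrite H.
by rewrite negb_forall => /existsP[r Hr]; rewrite (bigD1 r)//= (negbTE Hr) mul0r.
Qed.

(** A bulb ends in the parity of its switches, and a sign sees only that parity. *)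
Lemma chi_final S e : chi R S (final e) = \prod_(r < k) chi R S (e r).
Proof.
rewrite /chi exchange_big/=; apply: eq_bigr => j _.
rewrite inE /bulb_on signr_odd -prodr_const big_mkcond /=.
by apply: eq_bigr => r _; rewrite inE; case: (j \in e r).
Qed.

(** Both the probability of a configuration and the character of its final set split over the
    stages, so the sum over configurations becomes a product of one-stage sums. *)
Lemma final_law_fourier S :
  \sum_A final_law A * chi R S A = \prod_(r < k) rho R S (s r).
Proof.
transitivity (\sum_e config_prob s e * chi R S (final e)).
  rewrite [RHS](partition_big final predT)//=; apply: eq_bigr => A _.
  by rewrite mulr_suml; apply: eq_bigr => e /eqP->.
transitivity (\prod_(r < k) \sum_(A : {set 'I_n})
    (if #|A| == s r then ('C(n, s r)%:R)^-1 else 0) * chi R S A).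
  rewrite bigA_distr_bigA; apply: eq_bigr => e _.
  by rewrite config_probE chi_final -big_split.
apply: eq_bigr => r _; rewrite /rho /level_sum card_ord [RHS]mulrC mulr_sumr [RHS]big_mkcond.
by apply: eq_bigr => A _; case: ifP; rewrite ?mul0r.
Qed.

Lemma lb_prob_final (E : pred nat) :
  lb_prob s (fun e => E (Xs e)) = \sum_(A : {set 'I_n} | E #|A|) final_law A.
Proof.
rewrite /lb_prob (partition_big final (fun A => E #|A|))/=; last first.
  by move=> e; rewrite XsE.
apply: eq_bigr => A EA; apply: eq_bigl => e; rewrite XsE.
by case: eqP => [->|]; rewrite ?EA ?andbF.
Qed.

Lemma final_law_ge0 A : 0 <= final_law A.
Proof.
apply: sumr_ge0 => e _; rewrite config_probE.
by apply: prodr_ge0 => r _; case: ifP => // _; rewrite invr_ge0.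
Qed.

Lemma sum_final_law : (forall r, (s r <= n)%N) -> \sum_A final_law A = 1.
Proof.
move=> sn; have := final_law_fourier finset.set0.
rewrite [RHS]big1 => [<-|r _]; last by rewrite rho0 ?card_ord.
by apply: eq_bigr => A _; rewrite chi0 mulr1.
Qed.

End LawOfProcess.

Lemma sum_over_card (R : realFieldType) n (F : nat -> R) :
  \sum_(A : {set 'I_n}) F #|A| = \sum_(k < n.+1) 'C(n, k)%:R * F k.
Proof.
rewrite (partition_big (fun A : {set 'I_n} => inord #|A| : 'I_n.+1) predT)//=.
apply: eq_bigr => k _.
have -> : 'C(n, k) = 'C(#|'I_n|, k) by rewrite card_ord.
rewrite -sum_level mulr_suml.
apply: eq_big => [A|A /eqP <-].
  rewrite -val_eqE/= inordK// ltnS -[X in (_ <= X)%N](card_ord n).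
  exact: max_card.
by rewrite mul1r inordK// ltnS -[X in (_ <= X)%N](card_ord n) max_card.
Qed.

Lemma leq_n_bin n b : (0 < b < n)%N -> (n <= 'C(n, b))%N.
Proof.
elim: n b => [|n IH] [|b]//; rewrite ltnS => /andP[_ bn].
rewrite binS; have [bn'|] := ltnP b.+1 n.
  by have := IH b.+1; rewrite bn' => /(_ isT); have := bin_gt0 n b; lia.
move=> nb; have -> : n = b.+1 by lia.
by rewrite binn -bin_sub// subSnn bin1; lia.
Qed.

(** * The standard process against the parity-conditioned uniform law *)

Section StandardProcess.
Context {R : realType}.
Variable n : nat.
Hypothesis n256 : (256 <= n)%N.
Implicit Types (S A : {set 'I_n}).

Let P := @final_law R n n (@std_pattern n).
Let eps : R := \prod_(1 <= s < n.+1) (-1) ^+ s.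

(* The uniform law conditioned on the parity prescribed by [eps]. *)
Let Q A : R := (2 ^+ n)^-1 * (1 + eps * (-1) ^+ #|A|).

Let lam S : R := \prod_(1 <= s < n.+1) rho R S s.

Let P_fourier S : \sum_A P A * chi R S A = lam S.
Proof.
by rewrite final_law_fourier /lam big_add1/= big_mkord.
Qed.

Let Q_fourier S : \sum_A Q A * chi R S A = (S == finset.set0)%:R + eps * (S == finset.setT)%:R.
Proof.
have n20 : 2 ^+ n != 0 :> R by rewrite expf_neq0.
have -> : \sum_A Q A * chi R S A = (2 ^+ n)^-1 *
    (\sum_A chi R A S * chi R A finset.set0 + eps * \sum_A chi R A S * chi R A finset.setT).
  rewrite mulr_sumr -big_split mulr_sumr; apply: eq_bigr => A _ /=.
  by rewrite (chiC R A finset.set0) chi0 (chiC R A finset.setT) chiT (chiC R A S) /Q; ring.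
by rewrite !chi_orthogonal card_ord natrX; field.
Qed.

Let eps_sqr : eps ^+ 2 = 1.
Proof.
by rewrite /eps -prodrXl big1 => [//|s _]; rewrite -exprM mulnC exprM sqrrN !expr1n.
Qed.

Let lam0 : lam finset.set0 = 1.
Proof.
rewrite /lam big_nat big1 // => s /andP[_ sn].
by rewrite rho0// card_ord.
Qed.

Let lamT : lam finset.setT = eps.
Proof.
rewrite /lam /eps big_nat [RHS]big_nat; apply: eq_bigr => s /andP[_ sn].
by rewrite rhoT// card_ord.
Qed.

Let m := n./2.
Let sq := Num.sqrt n%:R : R.

Let sq0 : 0 < sq. Proof. by rewrite sqrtr_gt0 ltr0n (leq_trans _ n256). Qed.
Let sq2 : sq ^+ 2 = n%:R. Proof. by rewrite sqr_sqrtr. Qed.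

Let level_ratio s : (m <= s + 3)%N -> (s <= m + 4)%N ->
  (2 ^ n)%:R / 'C(n, s)%:R <= 2 * sq.
Proof.
move=> s1 s2; have := bin_near_half n256 s1 s2.
have C0 : (0 < 'C(n, s))%N by rewrite bin_gt0; lia.
rewrite -(ler_nat R) => H; rewrite ler_pdivrMr ?ltr0n//.
rewrite -(ler_pXn2r (n := 2)) ?nnegrE ?mulr_ge0 ?(ltW sq0)//.
have -> : (2 ^ n)%:R ^+ 2 = (4 ^ n)%:R :> R by rewrite -natrX -expnM mulnC expnM.
apply: le_trans H _; rewrite !natrM !exprMn sq2.
by rewrite le_eqVlt; apply/orP; left; apply/eqP; ring.
Qed.

(** For such S, C(n, |S|) >= n, so [rho_sqr_le] and [level_ratio] give n rho^2 <= 2 sqrt n. *)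
Let rho_central S s : S != finset.set0 -> S != finset.setT -> (m <= s + 3)%N -> (s <= m + 4)%N ->
  rho R S s ^+ 2 <= 2 / sq.
Proof.
move=> S0 ST s1 s2.
have sn : (s <= #|'I_n|)%N by rewrite card_ord; lia.
have b : (0 < #|S| < n)%N.
  rewrite card_gt0 S0 /= -[X in (_ < X)%N](card_ord n).
  by rewrite -cardsT proper_card// properT.
have := rho_sqr_le R S sn; rewrite card_ord => h.
have := le_trans h (level_ratio s1 s2) => {}h.
rewrite ler_pdivlMr//; rewrite -(ler_pM2r sq0).
apply: le_trans h; rewrite -mulrA -expr2 sq2.
by rewrite ler_wpM2l ?sqr_ge0// ler_nat leq_n_bin.
Qed.

Let rho_sqr01 S s : 0 <= rho R S s ^+ 2 <= 1.
Proof.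
rewrite sqr_ge0 -(real_normK (num_real _)).
by rewrite exprn_ile1// rho_norm.
Qed.

Let prod01 S a b : 0 <= \prod_(a <= s < b) rho R S s ^+ 2 <= 1.
Proof.
apply: (big_ind (fun x : R => 0 <= x <= 1)) => [|x y|s _]; last exact: rho_sqr01.
  by rewrite ler01 lexx.
by move=> /andP[x0 x1] /andP[y0 y1]; rewrite mulr_ge0// mulr_ile1.
Qed.

(** Five of the six central stages are bounded pointwise; stage m - 2 is kept so that its squares
    can be summed over S by Parseval. *)
Let lam_sqr_le S : S != finset.set0 -> S != finset.setT ->
  lam S ^+ 2 <= rho R S (m - 2) ^+ 2 * (2 / sq) ^+ 5.
Proof.
move=> S0 ST; rewrite /lam -prodrXl.
rewrite (big_cat_nat (n := (m - 2)%N))/=; [|lia|lia].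
rewrite [X in _ * X](big_cat_nat (n := (m + 4)%N))/=; [|lia|lia].
have /andP[a0 a1] := prod01 S 1 (m - 2); have /andP[b0 b1] := prod01 S (m + 4) n.+1.
have /andP[c0 c1] := prod01 S (m - 2) (m + 4).
apply: (@le_trans _ _ (\prod_(m - 2 <= s < m + 4) rho R S s ^+ 2)).
  apply: le_trans (ler_piMl _ a1) _; first by rewrite mulr_ge0.
  by rewrite ler_piMr.
rewrite big_ltn; last by rewrite /m; clear -n256; lia.
apply: ler_wpM2l; first exact: sqr_ge0.
have -> : (2 / sq) ^+ 5 = \prod_((m - 2).+1 <= s < m + 4) (2 / sq).
  by rewrite prodr_const_nat; congr (_ ^+ _); rewrite /m; clear -n256; lia.
rewrite big_nat [leRHS]big_nat; apply: ler_prod => s /andP[s1 s2].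
by rewrite sqr_ge0 rho_central//; move: s1 s2; rewrite /m; clear -n256; lia.
Qed.

Let sum_lam_sqr_le :
  \sum_S (lam S - ((S == finset.set0)%:R + eps * (S == finset.setT)%:R)) ^+ 2 <= 64 / n%:R ^+ 2.
Proof.
have T0 : (finset.setT : {set 'I_n}) != finset.set0 by rewrite -card_gt0 cardsT card_ord (leq_trans _ n256).
apply: (@le_trans _ _ (\sum_S rho R S (m - 2) ^+ 2 * (2 / sq) ^+ 5)).
  apply: ler_sum => S _.
  have c0 : 0 <= rho R S (m - 2) ^+ 2 * (2 / sq) ^+ 5.
    by rewrite mulr_ge0 ?sqr_ge0// exprn_ge0// divr_ge0// ltW.
  move: c0; have [->|S0] := eqVneq S finset.set0.
    by rewrite lam0 eq_sym (negbTE T0) mulr0 addr0 subrr expr0n.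
  have [->|ST] := eqVneq S finset.setT; first by rewrite lamT mulr1 add0r subrr expr0n.
  by move=> _; rewrite mulr0 addr0 subr0 lam_sqr_le.
(* The kept stage sums to at most 2 sqrt n, and 2 sqrt n (2 / sqrt n)^5 = 64 / n^2. *)
rewrite -mulr_suml sum_rho_sqr card_ord; last lia.
apply: le_trans (ler_wpM2r _ (level_ratio _ _)) _; rewrite ?exprn_ge0 ?divr_ge0 ?(ltW sq0)//; try lia.
rewrite -sq2 le_eqVlt; apply/orP; left; apply/eqP; field.
by rewrite gt_eqF.
Qed.

Let sum_sqr_dist : \sum_A (P A - Q A) ^+ 2 <= 64 / n%:R ^+ 2 / 2 ^+ n.
Proof.
rewrite ler_pdivlMr ?exprn_gt0// mulrC.
have := parseval (fun A => P A - Q A); rewrite card_ord natrX => <-.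
apply: le_trans sum_lam_sqr_le; rewrite le_eqVlt; apply/orP; left; apply/eqP.
apply: eq_bigr => S _; rewrite -P_fourier -Q_fourier -sumrB.
by congr (_ ^+ 2); apply: eq_bigr => A _; rewrite mulrBl.
Qed.

Let dist_event (E : pred {set 'I_n}) :
  `|\sum_(A | E A) P A - \sum_(A | E A) Q A| <= 8 / n%:R.
Proof.
have n0 : 0 < n%:R :> R by rewrite ltr0n (leq_trans _ n256).
have N0 : 0 < 2 ^+ n :> R by rewrite exprn_gt0.
(* With this t, the inequality |x| <= (t + x^2 / t) / 2 acts as Cauchy-Schwarz: over the 2^n sets, t
   and x^2 / t each sum to at most 8/n. *)
pose t : R := 8 / n%:R / 2 ^+ n.
have t0 : 0 < t by rewrite !divr_gt0.
rewrite -sumrB; apply: le_trans (ler_norm_sum _ _ _) _.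
apply: (@le_trans _ _ (\sum_A 2^-1 * (t + (P A - Q A) ^+ 2 / t))).
  rewrite big_mkcond; apply: ler_sum => A _.
  have B : `|P A - Q A| <= 2^-1 * (t + (P A - Q A) ^+ 2 / t).
    rewrite -(real_normK (num_real (P A - Q A))).
    set x := `|_|; rewrite -subr_ge0.
    have -> : 2^-1 * (t + x ^+ 2 / t) - x = (x - t) ^+ 2 / (2 * t).
      by field; rewrite gt_eqF.
    by rewrite divr_ge0 ?sqr_ge0// mulr_ge0// ltW.
  by case: ifP => // _; apply: le_trans B.
have st : \sum_(A : {set 'I_n}) t = 8 / n%:R.
  rewrite (sum_over_card _ (fun=> t)) -mulr_suml sum_bin /t.
  by field; rewrite !gt_eqF.
rewrite -mulr_sumr big_split/= st -mulr_suml.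
have h := sum_sqr_dist.
have {}h : (\sum_A (P A - Q A) ^+ 2) / t <= 8 / n%:R.
  rewrite ler_pdivrMr//; apply: le_trans h _.
  by rewrite le_eqVlt; apply/orP; left; apply/eqP; rewrite /t; field; rewrite !gt_eqF.
lra.
Qed.

Lemma std_lb_cdf_bin_cdf (sig z : R) : 0 < sig ->
  `|std_lb_cdf n sig z - bin_cdf n sig z| <= 8 / n%:R + (2 * Num.sqrt n%:R)^-1.
Proof.
move=> sig0; pose E k : bool := (k%:R - n%:R / 2) / sig <= z.
rewrite /std_lb_cdf (@lb_prob_final R n n (@std_pattern n) E) -/P.
have := dist_event (fun A => E #|A|).
have -> : \sum_(A : {set 'I_n} | E #|A|) Q A = bin_cdf n sig z +
    eps / 2 ^+ n * \sum_(k < n.+1) 'C(n, k)%:R * ((-1) ^+ k * (E k)%:R).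
  rewrite big_mkcond (sum_over_card _ (fun k =>
    if E k then (2 ^+ n)^-1 * (1 + eps * (-1) ^+ k) else 0)).
  rewrite /bin_cdf [in RHS]big_mkcond mulr_suml mulr_sumr -big_split/=.
  apply: eq_bigr => k _; rewrite -/(E k).
  by case: (E k) => /=; field; rewrite expf_neq0.
set al := eps / _ * _ => H.
suff : `|al| <= (2 * sq)^-1.
  set P' := \sum_(A | _) P A in H *.
  have := ler_normD (P' - (bin_cdf n sig z + al)) al.
  rewrite (_ : _ + al = P' - bin_cdf n sig z); last by ring.
  rewrite -/sq; lra.
have eps1 : `|eps| = 1.
  by apply/eqP; rewrite -(@pexpr_eq1 _ _ 2)// real_normK ?num_real// eps_sqr.
have [p np] : exists p, n = p.+1 by exists n.-1; lia.
clear H; rewrite {}/al normrM normf_div eps1 (ger0_norm (exprn_ge0 _ _))// div1r.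
rewrite mulrC ler_pdivrMr ?exprn_gt0// /sq.
move: @E; rewrite np => E.
(* Pascal's rule leaves the terms (-1)^k (E k - E (k+1)). As [E] is a threshold in k, only the k at
   which it switches off survives. *)
rewrite (sum_bin_pascal (fun k => (-1) ^+ k * (E k)%:R)); apply: le_trans (ler_norm_sum _ _ _) _.
apply: le_trans (_ : _ <= 2 ^+ p * (Num.sqrt p.+1%:R)^-1) _; last first.
  rewrite le_eqVlt; apply/orP; left; apply/eqP; rewrite exprS; field.
  by rewrite gt_eqF// sqrtr_gt0.
apply: le_trans (sum_bin_crossing_le p z sig0); apply: ler_sum => k _.
rewrite normrM normr_nat ler_wpM2l// -/(E k) ltNge -/(E k.+1) exprS.
have EE : E k.+1 ==> E k.
  apply/implyP; apply: le_trans.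
  by rewrite ler_pM2r ?invr_gt0// lerD2r ler_nat.
case: (E k.+1) EE => /= [->|_]; rewrite ?mulr1 ?mulN1r ?mulr0 ?subrr ?normr0//=.
by case: (E k) => /=; rewrite ?mulr1 ?mulr0 addr0 ?normr0// normrX normrN1 expr1n.
Qed.

End StandardProcess.

(** * Variance and numerical bounds *)

Section Lambda2.
Context {R : realType}.
Variable n : nat.
Hypothesis n6 : (6 <= n)%N.

Let nR : 6 <= n%:R :> R. Proof. by rewrite (ler_nat _ 6). Qed.

Lemma lambda2E s :
  lambda_nbs n 2 s = ((n%:R - 2 * s%:R) ^+ 2 - n%:R) / (n%:R * (n%:R - 1)) :> R.
Proof.
have n6R := nR.
have predR k : (k * k.-1)%:R = k%:R * (k%:R - 1) :> R.
  by case: k => [|k]; rewrite ?mul0r// natrM/= -natr1 addrK.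
rewrite /lambda_nbs !big_ord_recr big_ord0/= !ffactnS !ffactn0 !muln1 !predR.
rewrite !(bin0, bin1, binn).
by field; apply/andP; split; apply/eqP; lra.
Qed.

Lemma lambda2_norm_le1 s : (s <= n)%N -> `|lambda_nbs n 2 s : R| <= 1.
Proof.
have n6R := nR; move=> sn; have sR : s%:R <= n%:R :> R by rewrite ler_nat.
have s0 : 0 <= s%:R :> R by [].
have d0 : 0 < n%:R * (n%:R - 1) :> R by rewrite mulr_gt0; lra.
rewrite lambda2E ler_norml ler_pdivrMr// ler_pdivlMr//.
have h : s%:R * (n%:R - s%:R) >= 0 :> R by rewrite mulr_ge0// subr_ge0.
have h2 := sqr_ge0 (n%:R - 2 * s%:R : R).
have h3 : n%:R * 6 <= n%:R * n%:R :> R by rewrite ler_wpM2l.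
rewrite !expr2 in h2 *; apply/andP; split; lra.
Qed.

(** Here -2 <= n - 2s <= 3, so (n - 2s)^2 - n lies between -n and 9 - n <= n. *)
Lemma lambda2_central s : (n./2 <= s + 1)%N -> (s <= n./2 + 1)%N ->
  `|lambda_nbs n 2 s : R| <= (n%:R - 1)^-1.
Proof.
have n6R := nR; move=> s1 s2.
have a1 : n%:R <= 2 * s%:R + 3 :> R by rewrite -natrM -natrD ler_nat; lia.
have a2 : 2 * s%:R <= n%:R + 2 :> R by rewrite -natrM -natrD ler_nat; lia.
have n1 : 0 < n%:R - 1 :> R by lra.
rewrite lambda2E invfM mulrA normrM (normfV (n%:R - 1)) (gtr0_norm n1).
rewrite ler_piMl ?invr_ge0 ?(ltW n1)// normrM normfV normr_nat.
rewrite ler_pdivrMr ?mul1r; last lra.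
have h : (n%:R - 2 * s%:R) ^+ 2 <= 9 :> R.
  have : 0 <= (3 - (n%:R - 2 * s%:R)) * (3 + (n%:R - 2 * s%:R)) :> R.
    by rewrite mulr_ge0; lra.
  by rewrite expr2; lra.
by rewrite ler_norml; have := sqr_ge0 (n%:R - 2 * s%:R : R); lra.
Qed.

(** The three central factors give (n-1)^-3 and the others are at most 1. By [variance_form] the
    left-hand side is the relative deviation of the variance from n/4. *)
Lemma lambda_std2_le :
  (n%:R - 1) * `|lambda_std n 2 : R| <= ((n%:R - 1) ^+ 2)^-1.
Proof.
have n6R := nR; have n1 : 0 < n%:R - 1 :> R by lra.
have prod1 a b : (b <= n.+1)%N -> \prod_(a <= s < b) `|lambda_nbs n 2 s : R| <= 1.
  move=> bn; rewrite big_nat; apply: prodr_ile1 => s /andP[_ sb].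
  by rewrite normr_ge0 lambda2_norm_le1//; lia.
have prod0 a b : 0 <= \prod_(a <= s < b) `|lambda_nbs n 2 s : R|.
  by apply: prodr_ge0.
rewrite /lambda_std normr_prod.
rewrite (big_cat_nat (n := n./2.-1))/=; [|lia|lia].
rewrite [X in _ * (_ * X)](big_cat_nat (n := n./2.+2))/=; [|lia|lia].
have mid : \prod_(n./2.-1 <= s < n./2.+2) `|lambda_nbs n 2 s : R| <= (n%:R - 1)^-1 ^+ 3.
  have -> : (n%:R - 1)^-1 ^+ 3 = \prod_(n./2.-1 <= s < n./2.+2) (n%:R - 1)^-1 :> R.
    by rewrite prodr_const_nat; congr (_ ^+ _); lia.
  rewrite big_nat [leRHS]big_nat; apply: ler_prod => s /andP[s1 s2].
  by rewrite normr_ge0 lambda2_central//; lia.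
apply: (@le_trans _ _ ((n%:R - 1) * (n%:R - 1)^-1 ^+ 3)); last first.
  by rewrite le_eqVlt; apply/orP; left; apply/eqP; field; lra.
apply: ler_wpM2l; first exact: ltW.
apply: le_trans (ler_piMl _ (prod1 _ _ _)) _; [by rewrite mulr_ge0|lia|].
by apply: le_trans (ler_piMr _ (prod1 _ _ _)) mid; [|lia].
Qed.

(* For odd n the two averaged factors are equal when b = 2. *)
Lemma lambda_bar_std2 : odd n -> lambda_bar_std n 2 = lambda_std n 2 :> R.
Proof.
move=> on; rewrite /lambda_bar_std /lambda_std.
have e : lambda_nbs n 2 n./2 = lambda_nbs n 2 n./2.+1 :> R.
  rewrite !lambda2E; congr ((_ - _) / _).
  have -> : n%:R = 2 * n./2%:R + 1 :> R by rewrite -natrM natr1; congr _%:R; lia.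
  by rewrite -(natr1 n./2); ring.
have nm : n./2 \in index_iota 1 n.+1 by rewrite mem_index_iota; lia.
have nm1 : n./2.+1 \in index_iota 1 n.+1 by rewrite mem_index_iota; lia.
rewrite [RHS](bigD1_seq n./2) ?iota_uniq//=.
rewrite [X in _ = _ * X]big_mkcond [X in _ = _ * X](bigD1_seq n./2.+1) ?iota_uniq//=.
rewrite gtn_eqF// -big_mkcondr -e.
under eq_bigl => i do rewrite andbC.
set x := \prod_(_ <= _ < _ | _) _; rewrite -[X in _ = _ * (_ * X)]/x /=.
by field.
Qed.

End Lambda2.

(** * Explicit constants in units of 1 / sqrt n *)

Section Numerics.
Context {R : realType}.
Variables (n : nat) (sig del : R).
Hypothesis n6 : (6 <= n)%N.
Hypothesis sig0 : 0 < sig.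
Hypothesis sigE : sig ^+ 2 = n%:R / 4 * (1 + del).
Hypothesis delP : `|del| <= ((n%:R - 1) ^+ 2)^-1.

Let q := Num.sqrt n%:R : R.
Let q0 : 0 < q. Proof. by rewrite sqrtr_gt0 ltr0n; lia. Qed.
Let q2 : q ^+ 2 = n%:R. Proof. by rewrite sqr_sqrtr. Qed.

(** The variance is at most 0.26 n < 0.51^2 n, and 1.64 (100/51)^3 + 2 (100/51) > 16. *)
Lemma core_rhs_ge :
  16 / q <= 164%:R / 100%:R * (n%:R / sig ^+ 3) + 2 / sig.
Proof.
have nR : 6 <= n%:R :> R by rewrite (ler_nat _ 6).
have n25 : 25 <= (n%:R - 1) ^+ 2 :> R.
  have : 0 <= (n%:R - 6) * (n%:R + 4) :> R by rewrite mulr_ge0; lra.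
  by rewrite expr2; lra.
have d25 : del <= 25^-1.
  apply: le_trans (ler_norm _) (le_trans delP _).
  by rewrite lef_pV2 ?posrE// (lt_le_trans _ n25).
have sq : sig <= 51 / 100 * q.
  rewrite -(ler_pXn2r (n := 2)) ?nnegrE ?mulr_ge0 ?divr_ge0 ?(ltW q0) ?(ltW sig0)//.
  rewrite sigE exprMn q2; have := ler_wpM2l (ler0n R n) d25; lra.
have iq : (100 / 51) / q <= sig^-1.
  by rewrite ler_pdivrMr// [leRHS]mulrC ler_pdivlMr//; lra.
have iq3 : ((100 / 51) / q) ^+ 3 <= sig^-1 ^+ 3.
  by rewrite ler_pXn2r ?nnegrE ?invr_ge0 ?divr_ge0 ?(ltW q0) ?(ltW sig0).
have := ler_wpM2l (ler0n R n) iq3.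
have -> : n%:R * ((100 / 51) / q) ^+ 3 = (100 / 51) ^+ 3 / q.
  by rewrite -q2; field; rewrite gt_eqF.
rewrite -exprVn; have : 0 < q^-1 by rewrite invr_gt0.
set x := q^-1 in iq *; set y := sig^-1 in iq *; lra.
Qed.

(** In units of 1/q, with q >= 16, the terms are at most 1/2, 1/2, 2.01 (4.01 + 4.02/16) < 8.6, 0.04
    and 4, together below 14. *)
Lemma core_lhs_le : (256 <= n)%N ->
  8 / n%:R + (2 * q)^-1 + (sig^-1 * (3 + n%:R / (4 * sig ^+ 2) + 2 * sig^-1) +
   2 * `|1 - n%:R / (4 * sig ^+ 2)| + 4 * q^-1) <= 16 / q.
Proof.
move=> n256; have nR : 256 <= n%:R :> R by rewrite (ler_nat _ 256).
have q16 : 16 <= q.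
  by rewrite -(ler_pXn2r (n := 2)) ?nnegrE ?(ltW q0)// q2; lra.
have x0 : 0 < q^-1 by rewrite invr_gt0.
have x16 : q^-1 <= 16^-1 by rewrite lef_pV2 ?posrE.
have nx : n%:R^-1 <= 16^-1 * q^-1.
  by rewrite -q2 expr2 invfM ler_wpM2r// ltW.
have dx : `|del| <= 100^-1 * q^-1.
  apply: le_trans delP _; rewrite -invfM lef_pV2 ?posrE ?mulr_gt0 ?exprn_gt0//; try lra.
  by rewrite -q2 !expr2; have := ler_wpM2l (ltW q0) q16; nra.
have d1 : `|del| <= 1600^-1 by lra.
have [d1a d1b] : - 1600^-1 <= del /\ del <= 1600^-1 by by apply/andP; rewrite -ler_norml.
have kE : n%:R / (4 * sig ^+ 2) = (1 + del)^-1.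
  by rewrite sigE; field; apply/andP; split; apply/eqP; lra.
have k1 : (1 + del)^-1 <= 101 / 100.
  by rewrite -[leRHS]invrK lef_pV2 ?posrE ?invf_div; lra.
have k2 : `|1 - (1 + del)^-1| <= 2 * `|del|.
  have -> : 1 - (1 + del)^-1 = del * (1 + del)^-1 by field; apply/eqP; lra.
  rewrite normrM mulrC ler_wpM2r// ger0_norm ?invr_ge0; lra.
have sq : q / (201 / 100) <= sig.
  rewrite -(ler_pXn2r (n := 2)) ?nnegrE ?divr_ge0 ?(ltW q0) ?(ltW sig0)//.
  by rewrite sigE expr_div_n q2; have := ler_wpM2l (ler0n R n) d1a; lra.
have dq : sig^-1 <= 201 / 100 * q^-1.
  by rewrite ler_pdivlMr// [leLHS]mulrC ler_pdivrMr//; lra.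
rewrite kE invfM; set y := sig^-1 in dq *; set k := (1 + del)^-1 in k1 k2 *.
have y0 : 0 < y by rewrite invr_gt0.
have h1 : y * (3 + k + 2 * y) <= y * (401 / 100 + 2 * (201 / 100) * 16^-1).
  by apply: ler_wpM2l; [exact: ltW|lra].
lra.
Qed.

End Numerics.

(** * Normal approximation of the standard process *)

Section Assembly.
Context {R : realType}.

Lemma std_lb_cdf01 n (sig z : R) : 0 <= std_lb_cdf n sig z <= 1.
Proof.
pose E k : bool := (k%:R - n%:R / 2) / sig <= z.
rewrite /std_lb_cdf (@lb_prob_final R n n (@std_pattern n) E).
have P0 := @final_law_ge0 R n n (@std_pattern n).
rewrite sumr_ge0//= -(@sum_final_law R n n (@std_pattern n)); last first.
  by move=> r; exact: ltn_ord.
by rewrite big_mkcond ler_sum// => A _; case: ifP.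
Qed.

Lemma std_lb_cdf_normal n (sig del z : R) : (6 <= n)%N -> 0 < sig ->
  sig ^+ 2 = n%:R / 4 * (1 + del) -> `|del| <= ((n%:R - 1) ^+ 2)^-1 ->
  `|std_lb_cdf n sig z - Phi z| <=
    164%:R / 100%:R * (n%:R / sig ^+ 3) + 2 / sig.
Proof.
move=> n6 sig0 sigE delP; apply: le_trans (core_rhs_ge n6 sig0 sigE delP).
have q0 : 0 < Num.sqrt n%:R :> R by rewrite sqrtr_gt0 ltr0n; lia.
(* For n < 256 the bound 16 / sqrt n exceeds 1, while both distribution functions lie in [0, 1]. *)
have [n256|n256] := leqP 256 n; last first.
  apply: (@le_trans _ _ 1).
    have /andP[c0 c1] := std_lb_cdf01 n sig z.
    by rewrite ler_norml; have := Phi_ge0 z; have := Phi_le1 z; lra.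
  rewrite ler_pdivlMr// mul1r -(ler_pXn2r (n := 2)) ?nnegrE ?(ltW q0)//.
  rewrite sqr_sqrtr// -natrX ler_nat; lia.
apply: le_trans (core_lhs_le n6 sig0 sigE delP n256).
have h1 := std_lb_cdf_bin_cdf n256 z sig0.
have [p np] : exists p, n = p.+1 by exists n.-1; lia.
have := @bin_cdf_berry_esseen R p sig z sig0; rewrite -np => h2.
have := ler_normD (std_lb_cdf n sig z - bin_cdf n sig z) (bin_cdf n sig z - Phi z).
rewrite addrA subrK => /le_trans; apply; exact: lerD.
Qed.

Lemma variance_form (n : nat) (lam : R) : n%:R / 4 * (1 - lam) + n%:R ^+ 2 / 4 * lam =
  n%:R / 4 * (1 + (n%:R - 1) * lam).
Proof. by field. Qed.

Lemma normal_approx_of_lambda2 n (lam z : R) : (6 <= n)%N ->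
  lam = lambda_std n 2 ->
  let sig2 := n%:R / 4 * (1 - lam) + n%:R ^+ 2 / 4 * lam in
  let sig := Num.sqrt sig2 in
  [/\ 0 < sig2, 0 < sig & `|std_lb_cdf n sig z - Phi z| <=
    164%:R / 100%:R * (n%:R / sig ^+ 3) + 2 / sig].
Proof.
move=> n6 -> sig2 sig; have nR : 6 <= n%:R :> R by rewrite (ler_nat _ 6).
set L := lambda_std n 2 in sig2 sig *.
have dP : `|(n%:R - 1) * L| <= ((n%:R - 1) ^+ 2)^-1.
  by rewrite normrM ger0_norm ?lambda_std2_le//; lra.
have d1 : `|(n%:R - 1) * L| < 1.
  apply: le_lt_trans dP _; rewrite invf_lt1 ?exprn_gt0 ?exprn_egt1//; lra.
have s20 : 0 < sig2.
  rewrite /sig2 variance_form mulr_gt0//; first by lra.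
  by move: d1; rewrite ltr_norml => /andP[]; lra.
have s0 : 0 < sig by rewrite sqrtr_gt0.
split=> //; apply: (std_lb_cdf_normal _ n6 s0 _ dP).
by rewrite sqr_sqrtr ?(ltW s20)// /sig2 variance_form.
Qed.

End Assembly.

Theorem theorem1p1 (R : realType) :
  (forall n : nat, ~~ odd n -> (6 <= n)%N ->
    let sig2 : R := n%:R / 4 * (1 - lambda_std n 2) + n%:R ^+ 2 / 4 * lambda_std n 2 in
    let sig : R := Num.sqrt sig2 in
    let D0 : R := (2 * Num.sqrt n%:R)^-1 + (2 * n%:R)^-1 + 3^-1 * expR (- (n%:R / 2)) in
    forall z : R,
      `|std_lb_cdf n sig z - Phi z| <=
        n%:R / (2 * sig2) * D0 + (164%:R / 100%:R) * (n%:R / sig ^+ 3) + 2 / sig)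
  /\
  (forall n : nat, odd n -> (7 <= n)%N ->
    let sig2 : R := n%:R / 4 * (1 - lambda_bar_std n 2)
                    + n%:R ^+ 2 / 4 * lambda_bar_std n 2 in
    let sig : R := Num.sqrt sig2 in
    let D1 : R := (Num.sqrt n%:R)^-1 + (2 * Num.sqrt 2)^-1 * expR (- (n%:R / 4)) in
    forall z : R,
      `|std_lb_cdf n sig z - Phi z| <=
        n%:R / (2 * sig2) * D1 + (164%:R / 100%:R) * (n%:R / sig ^+ 3)
        + 2 / sig * (1 + (Num.sqrt (2 * pi))^-1)).
Proof.
split=> n parity nge sig2 sig D z.
- have [s20 s0 h] := normal_approx_of_lambda2 z nge (erefl _).
  (* The bound [h] is the sum of the last two terms; the first term is nonnegative. *)
  rewrite -addrA; apply: le_trans h _; rewrite lerDr.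
  rewrite mulr_ge0 ?divr_ge0 ?mulr_ge0 ?(ltW s20)//.
  by rewrite !addr_ge0 ?invr_ge0 ?mulr_ge0 ?invr_ge0 ?sqrtr_ge0 ?expR_ge0.
- have n6 : (6 <= n)%N by exact: ltnW.
  have [s20 s0 h] := normal_approx_of_lambda2 z n6 (lambda_bar_std2 n6 parity).
  (* The terms are compared one by one: the first is nonnegative, and the factor 1 + 1 / sqrt(2 pi)
     is at least 1. *)
  rewrite -addrA; apply: le_trans h _; rewrite -[leLHS]add0r.
  apply: lerD; last apply: lerD => //.
    rewrite mulr_ge0 ?divr_ge0 ?mulr_ge0 ?(ltW s20)//.
    by rewrite !addr_ge0 ?mulr_ge0 ?invr_ge0 ?mulr_ge0 ?sqrtr_ge0 ?expR_ge0.
  by rewrite ler_peMr ?divr_ge0 ?(ltW s0)// lerDl invr_ge0 sqrtr_ge0.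
Qed.
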